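(* For $z\in\mathbb{C}^+$ let $(u,v)=(u(z),v(z))\in\mathbb{C}^+\times\mathbb{C}^+$ be the solution of $$u=-\frac1N\sum_{k=1}^N\frac{\alpha_k}{z+\alpha_ku+\beta_kv},\qquad v=-\frac1N\sum_{k=1}^N\frac{\beta_k}{z+\alpha_ku+\beta_kv},$$ and put $m(z)=-\frac1N\sum_{k=1}^N\frac{1}{z+\alpha_ku+\beta_kv}$. Assume that $I\subset\mathbb{R}$ is a bounded interval and $c>0$ is a constant such that $\operatorname{Im}m\ge c$ on $\mathcal{D}_I=\{z:\operatorname{Re}z\in I,\ \operatorname{Im}z\in(0,10)\}$. Then there are $\varepsilon,C>0$, depending on $c$ (and on the fixed data $I$, $M$) but not on $N$, such that the following holds. For any $z\in\mathcal{D}_I$, if $(u',v')\in\mathbb{C}^2$ satisfies $$u'+\frac1N\sum_k\frac{\alpha_k}{z+\alpha_ku'+\beta_kv'}=r_1,\qquad v'+\frac1N\sum_k\frac{\beta_k}{z+\alpha_ku'+\beta_kv'}=r_2$$ and $\max\{|r_1|,|r_2|,|u'-u|,|v'-v|\}\le\varepsilon$, then $$\max\{|u'-u|,|v'-v|\}\le C\max\{|r_1|,|r_2|\}.$$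
   Context: $\mathbb{C}^+$ is the open upper half plane. $N\ge1$ is an integer and $\alpha_1,\dots,\alpha_N,\beta_1,\dots,\beta_N$ are real numbers (possibly depending on $N$) with $\alpha_k\ge1$, $\beta_k\ge1$ and $\frac1N\sum_{k=1}^N(\alpha_k^2+\beta_k^2)\le M$, where $M>0$ is a fixed constant not depending on $N$. For each $z\in\mathbb{C}^+$ the system for $(u,v)$ has a unique solution in $\mathbb{C}^+\times\mathbb{C}^+$. *)

(* Defs.v *)
From HB Require Import structures.
From mathcomp Require Import all_boot all_order all_algebra.
From mathcomp Require Import all_classical all_reals all_analysis.
From mathcomp Require Export complex.
Set Implicit Arguments.
Unset Strict Implicit.
Unset Printing Implicit Defensive.
Import Order.TTheory GRing.Theory Num.Theory.
Import numFieldNormedType.Exports.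

Local Open Scope ring_scope.
Local Open Scope classical_set_scope.
Local Open Scope complex_scope.

Section StieltjesSystem.
Context {R : realType}.

Definition upper_half_plane : set R[i] := [set z | 0 < complex.Im z].

(* The R-valued modulus; the library norm `|z| of a complex number lies in R[i]. *)
Definition cmod (z : R[i]) : R := ComplexField.Normc.normc z.

Context {N : nat}.
Implicit Types (alpha beta : 'I_N -> R) (z u v : R[i]).

Definition denom alpha beta z u v (k : 'I_N) : R[i] :=
  z + (alpha k)%:C * u + (beta k)%:C * v.

(* The inverse of 0 is 0 here.  No denominator vanishes for z, u, v in the open
   upper half plane and positive alpha, beta; for other u, v a vanishing
   denominator is not excluded. *)
Definition weighted_avg (w : 'I_N -> R) alpha beta z u v : R[i] :=
  N%:R^-1 * \sum_(k < N) (w k)%:C / denom alpha beta z u v k.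

Definition is_solution alpha beta z u v : Prop :=
  u = - weighted_avg alpha alpha beta z u v /\
  v = - weighted_avg beta alpha beta z u v.

Definition stieltjes_m alpha beta z u v : R[i] :=
  - (N%:R^-1 * \sum_(k < N) (denom alpha beta z u v k)^-1).

End StieltjesSystem.

Definition spectral_domain (R : realType) (I : set R) : set R[i] :=
  [set z | I (complex.Re z) /\ 0 < complex.Im z < 10].

(* Main.v *)
Require Import Defs.
From mathcomp Require Import all_boot all_order all_algebra.
From mathcomp Require Import all_classical all_reals all_analysis.
From mathcomp Require Import ring lra.
Import Order.TTheory GRing.Theory Num.Theory.
Import numFieldNormedType.Exports.
Local Open Scope ring_scope.
Local Open Scope classical_set_scope.
Local Open Scope complex_scope.

(** Write x = u' - u, y = v' - v, let D_k and D'_k be the denominators at (u, v)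
    and (u', v'), and put q_k = alpha_k x + beta_k y, so that D'_k = D_k + q_k.
    Subtracting the exact equations from the perturbed ones gives
    x - avg (alpha_k q_k / (D_k D'_k)) = r1, and likewise for y with beta_k.
    Testing these two equations against the conjugates of x and y turns the sum
    into a quadratic form ([quadratic_identity]):
      x^* r1 + y^* r2 = |x|^2 + |y|^2 - avg (|q_k|^2 / (D_k D'_k)).
    It remains to see that the real part of the right-hand side is at least
    s^2 (|x|^2 + |y|^2) for some s > 0 depending on c and I only.

    Two facts are combined.  First, taking imaginary parts in the system shows
    Im u = avg (alpha_k Im D_k / |D_k|^2) and the same for v, and
    Cauchy-Schwarz with the weights Im u and Im v then gives
    avg (|q_k|^2 / |D_k|^2) <= |x|^2 + |y|^2 ([quadratic_form_le]); in other
    words, the matrix of absolute values of the linearised system has norm at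
    most one.  Second, there is a strict gain from the phases: the lower bound on
    Im m keeps every D_k in a sector Im D_k >= s |D_k|, where
    Re D_k^-2 <= (1 - 2 s^2) / |D_k|^2, and replacing one factor D_k by D'_k
    costs at most s^2 / |D_k|^2 when q_k is small relative to D_k
    ([Re_inv_mul_perturb]).

    The sector bound is uniform because Im u and Im v dominate Im m >= c, so
    that c (alpha_k + beta_k) <= Im D_k <= |D_k| ([Im_denom_ge]); this makes
    |u| and |v| at most 1/c, hence |D_k| <= (|z| + 1/c) (alpha_k + beta_k)
    ([cmod_denom_le]).  Both bounds are linear in alpha_k + beta_k, so their
    ratio does not see the size of the coefficients, and q_k is small relative
    to D_k as soon as |x| and |y| are small relative to c. *)

(** * Moduli, real and imaginary parts *)

Section Modulus.
Set Implicit Arguments.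
Unset Strict Implicit.
Context {R : realType}.
Implicit Types (z w : R[i]) (a : R).

Lemma sqr_cmod z : cmod z ^+ 2 = complex.Re z ^+ 2 + complex.Im z ^+ 2.
Proof. by case: z => p q /=; rewrite /cmod /= sqr_sqrtr // addr_ge0 // sqr_ge0. Qed.

Lemma cmod_ge0 z : 0 <= cmod z.
Proof. by case: z => p q; exact: sqrtr_ge0. Qed.

Lemma cmodM z w : cmod (z * w) = cmod z * cmod w.
Proof. exact: ComplexField.Normc.normcM. Qed.

Lemma cmodV z : cmod z^-1 = (cmod z)^-1.
Proof. exact: ComplexField.Normc.normcV. Qed.

Lemma cmodN z : cmod (- z) = cmod z.
Proof. exact: normcN. Qed.

Lemma cmodD z w : cmod (z + w) <= cmod z + cmod w.
Proof. exact: le_normcD. Qed.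

Lemma cmod_real a : 0 <= a -> cmod a%:C = a.
Proof. by move=> a0; rewrite /cmod /= expr0n addr0 sqrtr_sqr ger0_norm. Qed.

Lemma cmod_conj z : cmod z^* = cmod z.
Proof. by case: z => p q; rewrite /cmod /= sqrrN. Qed.

Lemma cmod_eq0 z : (cmod z == 0) = (z == 0).
Proof.
apply/eqP/eqP => [|->]; first exact: ComplexField.Normc.eq0_normc.
exact: ComplexField.Normc.normc0.
Qed.

Lemma Re_le_cmod z : complex.Re z <= cmod z.
Proof.
apply: le_trans (ler_norm _) _.
rewrite -(ler_pXn2r (ltn0Sn 1)) ?nnegrE ?cmod_ge0 //.
by rewrite sqr_cmod real_normK ?num_real // lerDl sqr_ge0.
Qed.

Lemma Im_le_cmod z : complex.Im z <= cmod z.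
Proof.
apply: le_trans (ler_norm _) _.
rewrite -(ler_pXn2r (ltn0Sn 1)) ?nnegrE ?cmod_ge0 //.
by rewrite sqr_cmod real_normK ?num_real // lerDr sqr_ge0.
Qed.

Lemma cmod_le_norms z : cmod z <= `|complex.Re z| + `|complex.Im z|.
Proof.
rewrite -(ler_pXn2r (ltn0Sn 1)) ?nnegrE ?cmod_ge0 ?addr_ge0 //.
rewrite sqr_cmod sqrrD !real_normK ?num_real //.
have : 0 <= `|complex.Re z| * `|complex.Im z| by rewrite mulr_ge0.
lra.
Qed.

Lemma mul_conj z : z^* * z = (cmod z ^+ 2)%:C.
Proof. by rewrite sqr_cmod; case: z => p q; congr Complex => /=; ring. Qed.

Lemma ReD z w : complex.Re (z + w) = complex.Re z + complex.Re w.
Proof. by case: z w => ? ? []. Qed.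

Lemma ImD z w : complex.Im (z + w) = complex.Im z + complex.Im w.
Proof. by case: z w => ? ? []. Qed.

Lemma ReN z : complex.Re (- z) = - complex.Re z.
Proof. by case: z. Qed.

Lemma ImN z : complex.Im (- z) = - complex.Im z.
Proof. by case: z. Qed.

Lemma Re_realM a z : complex.Re (a%:C * z) = a * complex.Re z.
Proof. by case: z => p q /=; rewrite mul0r subr0. Qed.

Lemma Im_realM a z : complex.Im (a%:C * z) = a * complex.Im z.
Proof. by case: z => p q /=; rewrite mul0r addr0. Qed.

Lemma ReV z : complex.Re z^-1 = complex.Re z / cmod z ^+ 2.
Proof. by rewrite sqr_cmod; case: z. Qed.

Lemma ImV z : complex.Im z^-1 = - (complex.Im z / cmod z ^+ 2).
Proof. by rewrite sqr_cmod; case: z. Qed.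

Lemma conj_comb (a b : R) z w :
  ((a%:C * z + b%:C * w)^* = a%:C * z^* + b%:C * w^*)%R.
Proof. by case: z w => p q [p' q']; congr Complex => /=; ring. Qed.

Lemma Re_inv_sqr z :
  complex.Re (z * z)^-1 = (1 - 2 * (complex.Im z / cmod z) ^+ 2) / cmod z ^+ 2.
Proof.
have [e|z0] := eqVneq (cmod z) 0; first by rewrite ReV cmodM e expr0n mul0r expr0n !invr0 !mulr0.
rewrite ReV cmodM.
have -> : complex.Re (z * z) = cmod z ^+ 2 - 2 * complex.Im z ^+ 2.
  by rewrite sqr_cmod; case: (z) => p q /=; ring.
by field.
Qed.

(** The gain 2 s^2 that a point of the sector Im z >= s |z| offers in
    Re (z * z)^-1 is only halved when one of the two factors is moved slightly:
    the error w / (z^2 (z + w)) is at most s^2 / |z|^2 in modulus, since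
    |z + w| >= |z| / 2. *)
Lemma Re_inv_mul_perturb (s : R) z w : 0 < s -> s <= 1 -> z != 0 ->
  s * cmod z <= complex.Im z -> cmod w <= s ^+ 2 / 2 * cmod z ->
  complex.Re (z * (z + w))^-1 <= (1 - s ^+ 2) / cmod z ^+ 2.
Proof.
move=> s0 s1 z0 Imz smallw.
have n0 : 0 < cmod z by rewrite lt_def cmod_eq0 z0 cmod_ge0.
have s2 : s ^+ 2 <= 1 by apply: exprn_ile1 => //; exact: ltW.
have s20 : 0 < s ^+ 2 by rewrite exprn_gt0.
have lb : cmod z - cmod w <= cmod (z + w).
  by rewrite lerBlDr -(cmodN w) -[X in cmod X <= _](addrK w); exact: cmodD.
have n'_ge : cmod z / 2 <= cmod (z + w) by nra.
have n'0 : 0 < cmod (z + w) by lra.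
have zw0 : z + w != 0 by rewrite -cmod_eq0 gt_eqF.
have -> : (z * (z + w))^-1 = (z * z)^-1 + - (w / (z * z * (z + w))).
  by field; rewrite z0 zw0.
rewrite ReD Re_inv_sqr.
have e1 : complex.Re (- (w / (z * z * (z + w)))) <= s ^+ 2 / cmod z ^+ 2.
  apply: le_trans (Re_le_cmod _) _.
  rewrite cmodN cmodM cmodV !cmodM -expr2 ler_pdivrMr ?mulr_gt0 ?exprn_gt0 //.
  rewrite -mulrA mulKf ?gt_eqF ?exprn_gt0 //.
  by apply: le_trans smallw _; rewrite -mulrA ler_pM2l // mulrC.
have e2 : (1 - 2 * (complex.Im z / cmod z) ^+ 2) / cmod z ^+ 2 <=
          (1 - 2 * s ^+ 2) / cmod z ^+ 2.
  rewrite ler_pM2r ?invr_gt0 ?exprn_gt0 // lerD2l lerN2 ler_pM2l //.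
  have Imz0 : 0 <= complex.Im z by apply: le_trans Imz; rewrite mulr_ge0 // ltW.
  by rewrite ler_pXn2r ?nnegrE ?divr_ge0 ?ler_pdivlMr // ltW.
apply: le_trans (lerD e2 e1) _.
by rewrite -mulrDl; have -> : 1 - 2 * s ^+ 2 + s ^+ 2 = 1 - s ^+ 2 by ring.
Qed.

(** Cauchy-Schwarz with free positive weights p and q, applied to real and
    imaginary parts separately; the defect in the real case is
    a b (p t - q s)^2 / (p q). *)
Lemma sqr_cmod_comb_le (a b p q : R) (x y : R[i]) :
  0 <= a -> 0 <= b -> 0 < p -> 0 < q ->
  cmod (a%:C * x + b%:C * y) ^+ 2 <=
  (a * p + b * q) * (a * (cmod x ^+ 2 / p) + b * (cmod y ^+ 2 / q)).
Proof.
move=> a0 b0 p0 q0.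
have real_case (s t : R) : (a * s + b * t) ^+ 2 <=
    (a * p + b * q) * (a * (s ^+ 2 / p) + b * (t ^+ 2 / q)).
  rewrite -subr_ge0.
  have -> : (a * p + b * q) * (a * (s ^+ 2 / p) + b * (t ^+ 2 / q))
      - (a * s + b * t) ^+ 2 = a * b * (p * t - q * s) ^+ 2 / (p * q).
    by field; rewrite !gt_eqF.
  apply: divr_ge0; last by rewrite mulr_ge0 ?ltW.
  by rewrite mulr_ge0 ?sqr_ge0 ?mulr_ge0.
rewrite !sqr_cmod ReD ImD !Re_realM !Im_realM.
apply: le_trans (lerD (real_case _ _) (real_case _ _)) _.
by rewrite -mulrDr le_eqVlt; apply/orP; left; apply/eqP; congr (_ * _); ring.
Qed.

End Modulus.

(** * Averages *)

Section Average.
Set Implicit Arguments.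
Unset Strict Implicit.
Context {N : nat}.

Definition avg {K : fieldType} (F : 'I_N -> K) : K := N%:R^-1 * \sum_(k < N) F k.

Lemma eq_avg {K : fieldType} (F G : 'I_N -> K) : F =1 G -> avg F = avg G.
Proof. by move=> FG; rewrite /avg (eq_bigr G). Qed.

Lemma avgD {K : fieldType} (F G : 'I_N -> K) :
  avg (fun k => F k + G k) = avg F + avg G.
Proof. by rewrite /avg big_split mulrDr. Qed.

Lemma avgB {K : fieldType} (F G : 'I_N -> K) :
  avg (fun k => F k - G k) = avg F - avg G.
Proof. by rewrite /avg sumrB mulrBr. Qed.

Lemma avgZ {K : fieldType} (a : K) (F : 'I_N -> K) :
  avg (fun k => a * F k) = a * avg F.
Proof. by rewrite /avg -mulr_sumr mulrCA. Qed.

Context {R : realType}.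
Implicit Types (F G : 'I_N -> R) (H : 'I_N -> R[i]).

Lemma ler_avg F G : (forall k, F k <= G k) -> avg F <= avg G.
Proof. by move=> FG; rewrite ler_wpM2l ?invr_ge0 // ler_sum. Qed.

Lemma avg_cst_le (a : R) : 0 <= a -> avg (fun=> a) <= a.
Proof.
move=> a0; rewrite /avg sumr_const card_ord -[a *+ N]mulr_natl mulrA.
case: (N) => [|n]; first by rewrite mulr0 mul0r.
by rewrite mulVf ?pnatr_eq0 // mul1r.
Qed.

Lemma natCV : (N%:R : R[i])^-1 = (N%:R^-1 : R)%:C.
Proof. by rewrite fmorphV rmorph_nat. Qed.

Lemma Re_avg H : complex.Re (avg H) = avg (fun k => complex.Re (H k)).
Proof. by rewrite /avg natCV Re_realM raddf_sum. Qed.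

Lemma Im_avg H : complex.Im (avg H) = avg (fun k => complex.Im (H k)).
Proof. by rewrite /avg natCV Im_realM raddf_sum. Qed.

Lemma cmod_avg H : cmod (avg H) <= avg (fun k => cmod (H k)).
Proof.
rewrite /avg natCV cmodM cmod_real ?invr_ge0 // ler_wpM2l ?invr_ge0 //.
elim/big_ind2: _ => [|x a y b xa yb|//].
- by rewrite /cmod ComplexField.Normc.normc0.
- exact: le_trans (cmodD _ _) (lerD xa yb).
Qed.

End Average.

(** * The linearised system *)

Section Stability.
Set Implicit Arguments.
Unset Strict Implicit.
Context {R : realType} {N : nat}.
Implicit Types (z u v x y r : R[i]) (w : 'I_N -> R) (k : 'I_N).
Variables (alpha beta : 'I_N -> R).
Hypotheses (alpha_ge1 : forall k, 1 <= alpha k).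
Hypotheses (beta_ge1 : forall k, 1 <= beta k).

Lemma alpha_gt0 k : 0 < alpha k.
Proof. exact: lt_le_trans ltr01 (alpha_ge1 k). Qed.

Lemma beta_gt0 k : 0 < beta k.
Proof. exact: lt_le_trans ltr01 (beta_ge1 k). Qed.

Local Notation D := (denom alpha beta).
Local Notation wavg w z u v := (weighted_avg w alpha beta z u v).

Lemma weighted_avgE w z u v :
  wavg w z u v = avg (fun k => (w k)%:C / D z u v k).
Proof. by []. Qed.

Lemma Im_denom z u v k :
  complex.Im (D z u v k) =
  complex.Im z + alpha k * complex.Im u + beta k * complex.Im v.
Proof. by rewrite /denom !ImD !Im_realM. Qed.

Lemma denom_shift z u v x y k :
  D z (u + x) (v + y) k = D z u v k + ((alpha k)%:C * x + (beta k)%:C * y).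
Proof. by rewrite /denom; ring. Qed.

Lemma Im_weighted_avg w z u v :
  complex.Im (- wavg w z u v) =
  avg (fun k => w k * (complex.Im (D z u v k) / cmod (D z u v k) ^+ 2)).
Proof.
rewrite ImN weighted_avgE Im_avg -mulN1r -avgZ; apply: eq_avg => k.
by rewrite Im_realM ImV mulrN mulN1r opprK.
Qed.

Lemma weighted_avg_diff w z u v x y :
  (forall k, D z u v k != 0) -> (forall k, D z (u + x) (v + y) k != 0) ->
  wavg w z u v - wavg w z (u + x) (v + y) =
  avg (fun k => (w k)%:C * (((alpha k)%:C * x + (beta k)%:C * y) /
                  (D z u v k * D z (u + x) (v + y) k))).
Proof.
move=> D0 D'0; rewrite !weighted_avgE -avgB; apply: eq_avg => k.
move: (D0 k) (D'0 k); rewrite denom_shift => n0 n'0.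
by field; rewrite n0 n'0.
Qed.

(** Pairing the two equations for the increments with the conjugates of x and
    y makes the coefficients alpha_k x^* + beta_k y^* recombine into q_k^*, so
    that only |q_k|^2 and the product of the denominators survive. *)
Lemma quadratic_identity z u v x y r1 r2 :
  is_solution alpha beta z u v ->
  (forall k, D z u v k != 0) -> (forall k, D z (u + x) (v + y) k != 0) ->
  u + x + wavg alpha z (u + x) (v + y) = r1 ->
  v + y + wavg beta z (u + x) (v + y) = r2 ->
  x^* * r1 + y^* * r2 = (cmod x ^+ 2 + cmod y ^+ 2)%:C -
    avg (fun k => (cmod ((alpha k)%:C * x + (beta k)%:C * y) ^+ 2)%:C *
                  (D z u v k * D z (u + x) (v + y) k)^-1).
Proof.
move=> [eu ev] D0 D'0.
have -> : u + x + wavg alpha z (u + x) (v + y) =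
    x - (wavg alpha z u v - wavg alpha z (u + x) (v + y)).
  by rewrite {1}eu; ring.
have -> : v + y + wavg beta z (u + x) (v + y) =
    y - (wavg beta z u v - wavg beta z (u + x) (v + y)).
  by rewrite {1}ev; ring.
rewrite !weighted_avg_diff // => <- <-.
rewrite !mulrBr -!avgZ rmorphD /= -!mul_conj addrACA -opprD -avgD.
congr (_ - _); apply: eq_avg => k.
rewrite -mul_conj conj_comb.
ring.
Qed.

(** The positive vector (Im u, Im v) is a subsolution for the nonnegative
    symmetric matrix of this quadratic form, which therefore has norm at most
    one; the proof is the Schur test, with Im u and Im v as weights. *)
Lemma quadratic_form_le z u v x y :
  0 <= complex.Im z -> 0 < complex.Im u -> 0 < complex.Im v ->
  is_solution alpha beta z u v ->
  avg (fun k => cmod ((alpha k)%:C * x + (beta k)%:C * y) ^+ 2 /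
                cmod (D z u v k) ^+ 2) <= cmod x ^+ 2 + cmod y ^+ 2.
Proof.
move=> z0 u0 v0 [eu ev].
set X := cmod x ^+ 2 / complex.Im u; set Y := cmod y ^+ 2 / complex.Im v.
have -> : cmod x ^+ 2 + cmod y ^+ 2 = X * complex.Im u + Y * complex.Im v.
  by rewrite !divfK ?gt_eqF.
have -> : complex.Im u = avg (fun k =>
    alpha k * (complex.Im (D z u v k) / cmod (D z u v k) ^+ 2)).
  by rewrite {1}eu Im_weighted_avg.
have -> : complex.Im v = avg (fun k =>
    beta k * (complex.Im (D z u v k) / cmod (D z u v k) ^+ 2)).
  by rewrite {1}ev Im_weighted_avg.
rewrite -!avgZ -avgD; apply: ler_avg => k.
rewrite !mulrA -!mulrDl ler_wpM2r ?invr_ge0 ?sqr_ge0 //.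
have [a0 b0] := (ltW (alpha_gt0 k), ltW (beta_gt0 k)).
apply: le_trans (sqr_cmod_comb_le x y a0 b0 u0 v0) _.
rewrite mulrC (mulrC X) (mulrC Y) ler_wpM2l //.
  apply: addr_ge0; apply: mulr_ge0 => //; apply: divr_ge0;
    by rewrite ?sqr_ge0 // ltW.
by rewrite Im_denom -addrA lerDr.
Qed.

(** * Bounds where the imaginary part of m is bounded below *)

Section Bulk.
Variables (z u v : R[i]) (c : R).
Hypotheses (c_gt0 : 0 < c) (z_gt0 : 0 < complex.Im z).
Hypotheses (u_gt0 : 0 < complex.Im u) (v_gt0 : 0 < complex.Im v).
Hypothesis sol : is_solution alpha beta z u v.
Hypothesis Im_m_ge : c <= complex.Im (stieltjes_m alpha beta z u v).

Lemma Im_m_le_weighted w : (forall k, 1 <= w k) ->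
  c <= complex.Im (- wavg w z u v).
Proof.
move=> w_ge1; apply: le_trans Im_m_ge _.
rewrite Im_weighted_avg.
have -> : stieltjes_m alpha beta z u v = - avg (fun k => (D z u v k)^-1) by [].
rewrite ImN Im_avg -mulN1r -avgZ; apply: ler_avg => k.
rewrite ImV mulN1r opprK ler_peMl // divr_ge0 ?sqr_ge0 // Im_denom.
by rewrite !addr_ge0 ?mulr_ge0 // ltW ?alpha_gt0 ?beta_gt0.
Qed.

(** This is where the lower bound on Im m enters: as the weights alpha_k and
    beta_k are at least one, Im u and Im v are at least Im m. *)
Lemma Im_denom_ge k : c * (alpha k + beta k) <= complex.Im (D z u v k).
Proof.
have cu : c <= complex.Im u by rewrite {1}sol.1 Im_m_le_weighted.
have cv : c <= complex.Im v by rewrite {1}sol.2 Im_m_le_weighted.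
have hu : alpha k * c <= alpha k * complex.Im u by rewrite ler_pM2l ?alpha_gt0.
have hv : beta k * c <= beta k * complex.Im v by rewrite ler_pM2l ?beta_gt0.
rewrite Im_denom mulrDr !(mulrC c) -addrA; apply: le_trans (lerD hu hv) _.
by rewrite lerDr ltW.
Qed.

Lemma cmod_denom_ge k : c * (alpha k + beta k) <= cmod (D z u v k).
Proof. exact: le_trans (Im_denom_ge k) (Im_le_cmod _). Qed.

Lemma denom_neq0 k : D z u v k != 0.
Proof.
rewrite -cmod_eq0 gt_eqF // (lt_le_trans _ (cmod_denom_ge k)) //.
by rewrite mulr_gt0 // addr_gt0 ?alpha_gt0 ?beta_gt0.
Qed.

Lemma cmod_weighted_avg_le w : (forall k, 0 <= w k) ->
  (forall k, w k <= alpha k + beta k) -> cmod (wavg w z u v) <= c^-1.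
Proof.
move=> w0 wle; rewrite weighted_avgE.
apply: le_trans (cmod_avg _) _.
apply: le_trans (avg_cst_le (N := N) (a := c^-1) _); last by rewrite invr_ge0 ltW.
apply: ler_avg => k.
have n0 : 0 < cmod (D z u v k).
  by rewrite lt_def cmod_eq0 denom_neq0 cmod_ge0.
rewrite cmodM cmodV cmod_real // ler_pdivrMr // ler_pdivlMl //.
by apply: le_trans (cmod_denom_ge k); rewrite ler_pM2l.
Qed.

(** The lower bound for the denominators feeds back into the equations and
    bounds u and v by 1/c; alpha_k + beta_k >= 1 absorbs the summand z. *)
Lemma cmod_denom_le (B : R) k : cmod z <= B ->
  cmod (D z u v k) <= (B + c^-1) * (alpha k + beta k).
Proof.
move=> zB.
have uB : cmod u <= c^-1.
  rewrite sol.1 cmodN cmod_weighted_avg_le // => j.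
    by rewrite ltW ?alpha_gt0.
  by rewrite lerDl ltW ?beta_gt0.
have vB : cmod v <= c^-1.
  rewrite sol.2 cmodN cmod_weighted_avg_le // => j.
    by rewrite ltW ?beta_gt0.
  by rewrite lerDr ltW ?alpha_gt0.
have a0 := alpha_gt0 k; have b0 := beta_gt0 k.
apply: le_trans (cmodD _ _) _.
apply: le_trans (lerD (cmodD _ _) (lexx _)) _.
rewrite !cmodM !cmod_real ?(ltW a0) ?(ltW b0) //.
have ab1 : 1 <= alpha k + beta k by move: (alpha_ge1 k); lra.
have B0 : 0 <= B := le_trans (cmod_ge0 z) zB.
have hz : cmod z <= B * (alpha k + beta k).
  by apply: le_trans zB _; rewrite ler_peMr.
have hu : alpha k * cmod u <= alpha k * c^-1 by rewrite ler_pM2l.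
have hv : beta k * cmod v <= beta k * c^-1 by rewrite ler_pM2l.
lra.
Qed.

(** Coercivity: the phase gain beats the error of the linearisation, and what
    is left of the form |x|^2 + |y|^2 - avg (|q_k|^2 / (D_k D'_k)) is the
    fraction s^2 of |x|^2 + |y|^2. *)
Lemma stability_estimate s x y r1 r2 :
  0 < s -> s <= 1 -> (forall k, s * cmod (D z u v k) <= complex.Im (D z u v k)) ->
  u + x + wavg alpha z (u + x) (v + y) = r1 ->
  v + y + wavg beta z (u + x) (v + y) = r2 ->
  cmod x <= c * (s ^+ 2 / 2) -> cmod y <= c * (s ^+ 2 / 2) ->
  s ^+ 2 * (cmod x ^+ 2 + cmod y ^+ 2) <= cmod x * cmod r1 + cmod y * cmod r2.
Proof.
move=> s0 s1 sector e1 e2 smallx smally.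
pose q k := (alpha k)%:C * x + (beta k)%:C * y.
have s2 : s ^+ 2 <= 1 by apply: exprn_ile1 => //; exact: ltW.
have s20 : 0 < s ^+ 2 by rewrite exprn_gt0.
have smallq k : cmod (q k) <= s ^+ 2 / 2 * cmod (D z u v k).
  have a0 := alpha_gt0 k; have b0 := beta_gt0 k.
  apply: le_trans (cmodD _ _) _.
  rewrite !cmodM !cmod_real ?(ltW a0) ?(ltW b0) //.
  have hx := ler_wpM2l (ltW a0) smallx; have hy := ler_wpM2l (ltW b0) smally.
  have := ler_wpM2l (ltW s20) (cmod_denom_ge k).
  lra.
have D'0 k : D z (u + x) (v + y) k != 0.
  rewrite denom_shift -/(q k) addr_eq0; apply/eqP => eD.
  have n0 : 0 < cmod (D z u v k) by rewrite lt_def cmod_eq0 denom_neq0 cmod_ge0.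
  by have := smallq k; rewrite -(cmodN (q k)) -eD; nra.
have := quadratic_identity sol denom_neq0 D'0 e1 e2.
move=> /(congr1 (@complex.Re R)); rewrite !ReD ReN Re_avg /= => idRe.
have Q_le := quadratic_form_le x y (ltW z_gt0) u_gt0 v_gt0 sol.
(* |q_k|^2 is real, so the sector bound applies to each term of the average. *)
have avg_le : avg (fun k => complex.Re ((cmod (q k) ^+ 2)%:C *
      (D z u v k * D z (u + x) (v + y) k)^-1)) <=
    (1 - s ^+ 2) * (cmod x ^+ 2 + cmod y ^+ 2).
  apply: le_trans (ler_wpM2l _ Q_le); last by rewrite subr_ge0.
  rewrite -avgZ; apply: ler_avg => k.
  rewrite Re_realM denom_shift -/(q k) [leRHS]mulrCA ler_wpM2l ?sqr_ge0 //.
  exact: Re_inv_mul_perturb (denom_neq0 k) (sector k) (smallq k).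
have rx : complex.Re (x^* * r1) <= cmod x * cmod r1.
  by rewrite -(cmod_conj x) -cmodM Re_le_cmod.
have ry : complex.Re (y^* * r2) <= cmod y * cmod r2.
  by rewrite -(cmod_conj y) -cmodM Re_le_cmod.
rewrite /q in avg_le; lra.
Qed.

End Bulk.
End Stability.

Theorem theorem5p3 (R : realType) (M : R) (I : set R) (c : R) :
  0 < M -> is_interval I -> bounded_set I -> 0 < c ->
  exists eps C : R, 0 < eps /\ 0 < C /\
  forall (N : nat) (alpha beta : 'I_N -> R) (u v : R[i] -> R[i]),
    (1 <= N)%N ->
    (forall k, 1 <= alpha k) -> (forall k, 1 <= beta k) ->
    N%:R^-1 * \sum_(k < N) (alpha k ^+ 2 + beta k ^+ 2) <= M ->
    (forall z, upper_half_plane z ->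
       upper_half_plane (u z) /\ upper_half_plane (v z) /\
       is_solution alpha beta z (u z) (v z)) ->
    (forall z, spectral_domain I z ->
       c <= complex.Im (stieltjes_m alpha beta z (u z) (v z))) ->
    forall z u' v' r1 r2 : R[i], spectral_domain I z ->
      u' + weighted_avg alpha alpha beta z u' v' = r1 ->
      v' + weighted_avg beta alpha beta z u' v' = r2 ->
      Num.max (Num.max (cmod r1) (cmod r2))
              (Num.max (cmod (u' - u z)) (cmod (v' - v z))) <= eps ->
      Num.max (cmod (u' - u z)) (cmod (v' - v z))
        <= C * Num.max (cmod r1) (cmod r2).
Proof.
move=> _ _ /pinfty_ex_gt0 [B B0 /= I_le] c0.
(* |z| + 1/c <= L on the spectral domain, hence |D_k| <= (L / c) Im D_k; the
   summand 1 in the inverse of s only ensures s <= 1. *)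
pose L := B + 10 + c^-1.
have L0 : 0 < L by rewrite !addr_gt0 ?invr_gt0.
pose s := (1 + L / c)^-1.
have K0 : 0 < 1 + L / c by rewrite addr_gt0 ?divr_gt0.
have s0 : 0 < s by rewrite invr_gt0.
have s1 : s <= 1 by rewrite invf_le1 // lerDl divr_ge0 // ltW.
have s20 : 0 < s ^+ 2 by rewrite exprn_gt0.
exists (c * (s ^+ 2 / 2)), (2 / s ^+ 2).
split; first by rewrite mulr_gt0 ?divr_gt0.
split; first by rewrite divr_gt0.
move=> N al be u v _ al1 be1 _ sol bulk z u' v' r1 r2 zI e1 e2.
have [z_re /andP[z0 z10]] := zI.
have [/= u0 [/= v0 solz]] := sol z z0.
have mz := bulk z zI.
have zB : cmod z <= B + 10.
  apply: le_trans (cmod_le_norms z) _; apply: lerD.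
    exact: I_le.
  by rewrite gtr0_norm // ltW.
have sector k : s * cmod (denom al be z (u z) (v z) k) <=
    complex.Im (denom al be z (u z) (v z) k).
  have Dle := cmod_denom_le al1 be1 c0 z0 u0 v0 solz mz k zB.
  have Dge := Im_denom_ge al1 be1 z0 u0 v0 solz mz k.
  have ab0 := addr_gt0 (alpha_gt0 al1 k) (beta_gt0 be1 k).
  rewrite mulrC ler_pdivrMr //.
  apply: le_trans Dle _; rewrite -/L.
  apply: (@le_trans _ _ (c * (al k + be k) * (L / c))).
    by rewrite le_eqVlt; apply/orP; left; apply/eqP; field; rewrite gt_eqF.
  apply: ler_pM => //.
  - by rewrite mulr_ge0 // ltW.
  - by rewrite divr_ge0 // ltW.
  - by rewrite lerDr.
move: e1 e2.
set x := u' - u z; set y := v' - v z.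
have -> : u' = u z + x by rewrite addrC subrK.
have -> : v' = v z + y by rewrite addrC subrK.
move=> e1 e2; rewrite [in X in X -> _]ge_max => /andP[_].
rewrite [in X in X -> _]ge_max => /andP[smallx smally].
have := stability_estimate al1 be1 c0 z0 u0 v0 solz mz s0 s1 sector
  e1 e2 smallx smally.
set rho := Num.max (cmod r1) (cmod r2); set del := Num.max (cmod x) (cmod y).
move=> est.
have r1le : cmod r1 <= rho by rewrite le_max lexx.
have r2le : cmod r2 <= rho by rewrite le_max lexx orbT.
have xle : cmod x <= del by rewrite le_max lexx.
have yle : cmod y <= del by rewrite le_max lexx orbT.
have del2 : del ^+ 2 <= cmod x ^+ 2 + cmod y ^+ 2.
  by rewrite /del /Num.max; case: ifP => _; rewrite ?lerDl ?lerDr sqr_ge0.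
have del0 : 0 <= del := le_trans (cmod_ge0 x) xle.
have rho0 : 0 <= rho := le_trans (cmod_ge0 r1) r1le.
have {est} est : s ^+ 2 * del * del <= 2 * rho * del.
  rewrite -mulrA -expr2; apply: le_trans (ler_wpM2l (ltW s20) del2) _.
  apply: le_trans est _.
  have h1 := ler_pM (cmod_ge0 x) (cmod_ge0 r1) xle r1le.
  have h2 := ler_pM (cmod_ge0 y) (cmod_ge0 r2) yle r2le.
  lra.
have [d0|/eqP d0] := eqVneq del 0; first by rewrite d0 mulr_ge0 // divr_ge0 // ltW.
rewrite mulrAC ler_pdivlMr // mulrC -(@ler_pM2r _ del) // lt_def del0 andbT.
exact/eqP.
Qed.
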